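(* For every $\alpha > 2/e$, there is no family of truthful direct-revelation mechanisms (one for each number of rounds $T$) for the two-bidder game ($k=2$) that is $\alpha$-competitive against selling the business.
   Context: Multiple-bidder game: there are $k\ge 2$ bidders and $T$ rounds; in each round the seller has one divisible item. Bidder $i$ has value $v_{i,t}\in[0,1]$ for the round-$t$ item; the values are arbitrary (adversarial), unknown to the seller, and each bidder knows all of its own values. A type profile is $\mathbf v=(v_{i,t})_{i\in[k],t\in[T]}$; write $|\mathbf v_i|=\sum_{t=1}^T v_{i,t}$. A direct-revelation mechanism specifies, for every profile $\mathbf v$, allocation fractions $r_{\mathbf v,i,t}\in[0,1]$ with $\sum_i r_{\mathbf v,i,t}\le 1$, prices $x_{\mathbf v,i,t}$, and end-of-game reimbursements $g_{\mathbf v,i}$. It is run as follows: bidders report their types; in round $t$ each non-eliminated bidder $i$ receives fraction $r_{\mathbf v,i,t}$ and must pay $x_{\mathbf v,i,t}$; a bidder who pays a different amount is eliminated (never allocated to or reimbursed again); at the end each non-eliminated bidder $i$ receives $g_{\mathbf v,i}$. The mechanism is truthful if (limited liability) $x_{\mathbf v,i,t}\le r_{\mathbf v,i,t}v_{i,t}$ for all $\mathbf v,i,t$, and (incentive compatibility) for every $\mathbf v$, bidder $i$, profile $\mathbf v'$ obtained from $\mathbf v$ by replacing bidder $i$'s type, and $\tau\le T$ such that $x_{\mathbf v',i,t}\le r_{\mathbf v',i,t}v_{i,t}$ for all $t\le\tau$, we have $\sum_{t=1}^T (r_{\mathbf v,i,t}v_{i,t}-x_{\mathbf v,i,t})+g_{\mathbf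 v,i}\ \ge\ \sum_{t=1}^{\tau}(r_{\mathbf v',i,t}v_{i,t}-x_{\mathbf v',i,t})+x_{\mathbf v',i,\tau}$. Revenue is ${\sf Rev}(\mathbf v)=\sum_i\sum_t x_{\mathbf v,i,t}-\sum_i g_{\mathbf v,i}$. The ''selling the business'' benchmark is ${\sf Rev}_{STB}(\mathbf v)=$ the second largest element of $\{|\mathbf v_i|: i\in[k]\}$. A family of mechanisms (one for each $T$) is $\alpha$-competitive against selling the business if there is a constant $C$ (depending only on $k$) such that for all $T$ and all type profiles $\mathbf v$, ${\sf Rev}(\mathbf v)\ge \alpha\,{\sf Rev}_{STB}(\mathbf v)-C$. *)

(* Defs.v *)
From HB Require Import structures.
From mathcomp Require Import all_boot all_order all_algebra.
From mathcomp Require Import all_classical all_reals all_analysis.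
Set Implicit Arguments. Unset Strict Implicit. Unset Printing Implicit Defensive.
Import Order.TTheory GRing.Theory Num.Theory.
Local Open Scope ring_scope.

Section Game.
Variable R : realType.

Definition btype (T : nat) := 'I_T -> R.
Definition profile (T : nat) := 'I_2 -> btype T.

Definition valid_type (T : nat) (w : btype T) : Prop :=
  forall t, 0 <= w t <= 1.
Definition valid_profile (T : nat) (v : profile T) : Prop :=
  forall i, valid_type (v i).

Definition replace_type (T : nat) (v : profile T) (i : 'I_2) (w : btype T)
  : profile T := fun j => if j == i then w else v j.

Record mechanism (T : nat) := Mechanism {
  alloc : profile T -> 'I_2 -> 'I_T -> R;
  price : profile T -> 'I_2 -> 'I_T -> R;
  reimb : profile T -> 'I_2 -> R }.

Definition feasible_alloc (T : nat) (M : mechanism T) : Prop :=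
  forall v, valid_profile v ->
    (forall i t, 0 <= alloc M v i t <= 1) /\
    (forall t, \sum_(i < 2) alloc M v i t <= 1).

Definition limited_liability (T : nat) (M : mechanism T) : Prop :=
  forall v, valid_profile v ->
    forall i t, price M v i t <= alloc M v i t * v i t.

(* Incentive compatibility: for every deviation v' (bidder i reports w instead)
   and every round tau (1-based tau = val tau + 1) such that the deviating
   bidder's prices up to tau are within its true value of the allocation,
   truthful utility >= utility of deviating and defaulting at round tau. *)
Definition incentive_compatible (T : nat) (M : mechanism T) : Prop :=
  forall v, valid_profile v ->
  forall (i : 'I_2) (w : btype T), valid_type w ->
  let v' := replace_type v i w in
  forall tau : 'I_T,
    (forall t : 'I_T, (t <= tau)%N ->
        price M v' i t <= alloc M v' i t * v i t) ->
    \sum_(t < T | (t <= tau)%N) (alloc M v' i t * v i t - price M v' i t)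
      + price M v' i tau
    <= \sum_(t < T) (alloc M v i t * v i t - price M v i t) + reimb M v i.

Definition truthful (T : nat) (M : mechanism T) : Prop :=
  [/\ feasible_alloc M, limited_liability M & incentive_compatible M].

Definition revenue (T : nat) (M : mechanism T) (v : profile T) : R :=
  \sum_(i < 2) \sum_(t < T) price M v i t - \sum_(i < 2) reimb M v i.

Definition total_value (T : nat) (v : profile T) (i : 'I_2) : R :=
  \sum_(t < T) v i t.

(* second largest of {|v_1|, |v_2|} (as a multiset) = the minimum *)
Definition rev_STB (T : nat) (v : profile T) : R :=
  Num.min (total_value v ord0) (total_value v (lift ord0 ord0)).

Definition competitive (alpha : R) (M : forall T, mechanism T) : Prop :=
  exists C : R, forall T (v : profile T), valid_profile v ->
    revenue (M T) v >= alpha * rev_STB v - C.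

End Game.

(* Main.v *)
Require Import Defs.
From HB Require Import structures.
From mathcomp Require Import all_boot all_order all_algebra.
From mathcomp Require Import all_classical all_reals all_analysis.
From mathcomp Require Import ring lra zify.
Import Order.TTheory GRing.Theory Num.Theory.
Local Open Scope ring_scope.
Set Implicit Arguments. Unset Strict Implicit. Unset Printing Implicit Defensive.

(** Every type used has total value P. A type w is modified by following it
    until a random round t and then spending the remaining value P - W_t at a
    constant, much higher rate. The modified type can imitate w and default once
    its own value is exhausted; since w is nearly worthless meanwhile, this earns
    it about (P - W_t) times the allocation of w around t. Choosing t with
    probability w_t / (P - W_t) until a fraction 1 - 1/e of P has been received
    (total mass log e = 1) bounds the allocated value of w by P/e plus the mean
    utility of the modified type. Hence the payment of w is at most P/e plus the
    mean increase of utility under the modification. Utilities are O(P), so when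
    the modification is iterated n times the increases telescope, and the average
    payment over the stages is at most P (1/e + O(1/n)). Doing this independently
    for both bidders bounds the average revenue by P (2/e + O(1/n)), while the
    benchmark is always P. *)

(** * Ramps, stopping hazards and their total mass *)

Section Stopping.
Variable R : realType.
Implicit Types (w r : nat -> R) (P : R).

Definition cumul w (t : nat) : R := \sum_(s < t) w s.

Definition cut P w (t L s : nat) : R :=
  if (s < t)%N then w s
  else if (s < t + L)%N then (P - cumul w t) / L%:R else 0.

Definition threshold P : R := P * (1 - expR (-1)).

(* Sub-probability; [step] leaves [w] unchanged with the remaining mass. *)
Definition hazard P w (t : nat) : R :=
  if cumul w t.+1 <= threshold P then w t / (P - cumul w t) else 0.

(** The invariant kept by the modification: [P / L] caps the rate and [N] bounds the support.
    Monotonicity is asked only on active rounds, those ending at or below the threshold, the only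
    ones that can carry a positive hazard. *)
Definition ramp P (L N : nat) w : Prop :=
  [/\ forall t, 0 <= w t <= P / L%:R,
      forall t, (N <= t)%N -> w t = 0,
      cumul w N = P &
      forall s t, (s <= t)%N -> cumul w t.+1 <= threshold P -> w s <= w t].

Lemma cumulS w t : cumul w t.+1 = cumul w t + w t.
Proof. by rewrite /cumul big_ord_recr. Qed.

Lemma cumul_le w s t :
  (forall u, 0 <= w u) -> (s <= t)%N -> cumul w s <= cumul w t.
Proof.
move=> w0; elim: t => [|t IH]; first by rewrite leqn0 => /eqP ->.
rewrite leq_eqVlt => /orP[/eqP -> //|]; rewrite ltnS => /IH /le_trans; apply.
by rewrite cumulS lerDl.
Qed.

Lemma cumul_stable w N t : (forall u, (N <= u)%N -> w u = 0) ->
  (N <= t)%N -> cumul w t = cumul w N.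
Proof.
move=> w0; elim: t => [|t IH]; first by rewrite leqn0 => /eqP ->.
rewrite leq_eqVlt => /orP[/eqP -> //|]; rewrite ltnS => Nt.
by rewrite cumulS w0 // addr0 IH.
Qed.

Lemma expRN1_itv : 0 < expR (-1 : R) < 1.
Proof. by rewrite expR_gt0 expR_lt1 ltrN10. Qed.

Lemma threshold_lt P : 0 < P -> threshold P < P.
Proof. by move=> P0; have /andP[? ?] := expRN1_itv; rewrite /threshold; nra. Qed.

Section Ramp.
Variables (P : R) (L N : nat) (w : nat -> R).
Hypotheses (P_gt0 : 0 < P) (ramp_w : ramp P L N w).

Lemma ramp_ge0 t : 0 <= w t.
Proof. by case: ramp_w => /(_ t)/andP[]. Qed.

Lemma ramp_le t : w t <= P / L%:R.
Proof. by case: ramp_w => /(_ t)/andP[]. Qed.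

Lemma ramp_total T : (N <= T)%N -> cumul w T = P.
Proof. by case: ramp_w => _ w0 <- _; exact: cumul_stable. Qed.

Lemma ramp_active t : cumul w t.+1 <= threshold P -> (t < N)%N.
Proof.
move=> act; rewrite ltnNge; apply/negP => Nt.
by move: act; rewrite ramp_total ?leqW // leNgt threshold_lt.
Qed.

(** Since [cumul w] is nondecreasing, the active rounds form an initial segment; it ends before [N]
    because the total [P] exceeds the threshold. *)
Lemma ramp_stop : exists m, (m < N)%N /\
  forall t, (cumul w t.+1 <= threshold P) = (t < m)%N.
Proof.
have ex : exists t, ~~ (cumul w t.+1 <= threshold P).
  by exists N; apply/negP => /ramp_active; rewrite ltnn.
pose m := ex_minn ex.
have mP t : (cumul w t.+1 <= threshold P) = (t < m)%N.
  rewrite /m; case: ex_minnP => n Hn min_n; case: ltnP => nt.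
    by apply/negPn/negP => /min_n; rewrite leqNgt nt.
  apply: contraNF Hn; apply: le_trans.
  by apply: cumul_le; [exact: ramp_ge0 | rewrite ltnS].
exists m; split => //; case: (posnP m) => [->|m0]; last first.
  have mt : cumul w m <= threshold P by rewrite -[m]prednK // mP prednK.
  rewrite ltnNge; apply/negP => Nm.
  by move: mt; rewrite ramp_total // leNgt threshold_lt.
rewrite lt0n; apply/eqP => N0; case: ramp_w => _ _.
by rewrite N0 /cumul big_ord0 => /eqP; rewrite lt_eqF.
Qed.

Lemma active_cumul_le t : cumul w t.+1 <= threshold P -> cumul w t <= threshold P.
Proof. by apply: le_trans; rewrite cumulS lerDl ramp_ge0. Qed.

Lemma active_remaining t :
  cumul w t.+1 <= threshold P -> P * expR (-1) <= P - cumul w t.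
Proof. by move/active_cumul_le; rewrite /threshold; lra. Qed.

Lemma active_remaining_gt0 t :
  cumul w t.+1 <= threshold P -> 0 < P - cumul w t.
Proof.
by move/active_remaining; apply: lt_le_trans; rewrite mulr_gt0 ?expR_gt0.
Qed.

Lemma hazard_ge0 t : 0 <= hazard P w t.
Proof.
rewrite /hazard; case: ifP => // act.
by rewrite divr_ge0 ?ramp_ge0 ?ltW ?active_remaining_gt0.
Qed.

(* [expR (- \sum_(t < n) hazard t)] dominates the fraction of [P] not yet
   received, because [1 - q <= expR (- q)]. *)
Lemma hazard_sum_le1 n : \sum_(t < n) hazard P w t <= 1.
Proof.
(* The exponential bound is maintained only up to the threshold; beyond it the hazards vanish and
   the sum no longer grows. *)
suff [] : \sum_(t < n) hazard P w t <= 1 /\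
    (cumul w n <= threshold P ->
     (P - cumul w n) / P <= expR (- \sum_(t < n) hazard P w t)) by [].
elim: n => [|n [IH1 IH2]].
  rewrite big_ord0; split=> [|_]; first exact: ler01.
  by rewrite /cumul big_ord0 subr0 divff ?gt_eqF // oppr0 expR0.
rewrite big_ord_recr /= {2 4}/hazard; case: ifP => [act|_]; last first.
  by rewrite addr0; split.
have act' := active_cumul_le act.
have D := active_remaining_gt0 act.
set q := w n / _; set S := \sum_(_ < _) _ in IH1 IH2 *.
have key : (P - cumul w n.+1) / P <= expR (- (S + q)).
  rewrite opprD expRD.
  have -> : (P - cumul w n.+1) / P = (P - cumul w n) / P * (1 - q).
    by rewrite /q cumulS; field; rewrite !gt_eqF.
  have q1 : 0 <= 1 - q.
    rewrite /q subr_ge0 ler_pdivrMr // mul1r.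
    have := threshold_lt P_gt0; move: act; rewrite cumulS; lra.
  apply: ler_pM => //; first by rewrite divr_ge0 // ltW.
    exact: IH2.
  exact: expR_ge1Dx.
(* After an active round at least the fraction [expR (-1)] of [P] remains, so the exponent in [key]
   is at least -1. *)
split=> //; rewrite -lerN2 -ler_expR; apply: le_trans key.
by rewrite ler_pdivlMr // mulrC; move: act; rewrite /threshold; lra.
Qed.

End Ramp.

(** Lets a type that a step leaves unchanged count as a type of the next stage. *)
Lemma ramp_weaken P L N L' N' w : 0 <= P -> (0 < L' <= L)%N -> (N <= N')%N ->
  ramp P L N w -> ramp P L' N' w.
Proof.
move=> P0 /andP[L'0 LL] NN rw; case: (rw) => b z tot mono; split => //.
- move=> t; have /andP[-> /= /le_trans] := b t; apply.
  by rewrite ler_wpM2l // lef_pV2 ?posrE ?ltr0n ?ler_nat //; apply: leq_trans LL.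
- by move=> t /(leq_trans NN); exact: z.
- exact: ramp_total NN.
Qed.

(** * Cutting a ramp yields a steeper ramp *)

Lemma cumul_cut_lo P w t L s : (s <= t)%N -> cumul (cut P w t L) s = cumul w s.
Proof.
move=> st; apply: eq_bigr => i _; rewrite /cut ifT //.
exact: leq_trans (ltn_ord i) st.
Qed.

Lemma cumul_cut P w t L : (0 < L)%N -> cumul (cut P w t L) (t + L) = P.
Proof.
move=> L0; rewrite /cumul big_split_ord /=.
rewrite (eq_bigr (fun i : 'I_t => w i)); last first.
  by move=> i _; rewrite /cut ltn_ord.
rewrite (eq_bigr (fun i : 'I_L => (P - cumul w t) / L%:R)); last first.
  by move=> i _; rewrite /cut ltnNge leq_addr /= ltn_add2l ltn_ord.
rewrite sumr_const card_ord -(mulr_natr (_ / _)) divfK ?pnatr_eq0 -?lt0n //.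
by rewrite -/(cumul w t) addrC subrK.
Qed.

(** At an active round at least [P / e] remains, so [L' <= L / e] makes the new rate at least
    [P / L], the cap on [w]. The jump at [t] is therefore upwards and monotonicity survives. *)
Lemma ramp_cut P L N w L' t : 0 < P -> (0 < L')%N ->
  L'%:R <= L%:R * expR (-1) :> R -> ramp P L N w ->
  cumul w t.+1 <= threshold P -> ramp P L' (N + L') (cut P w t L').
Proof.
move=> P0 L'0 LL rw act; case: (rw) => b z tot mono.
have L'R : 0 < L'%:R :> R by rewrite ltr0n.
have LR : 0 < L%:R :> R.
  by rewrite -(pmulr_lgt0 _ (expR_gt0 (-1))); apply: lt_le_trans LL.
have D := active_remaining_gt0 P0 rw act.
have C : P / L%:R <= (P - cumul w t) / L'%:R.
  rewrite ler_pdivlMr // mulrAC ler_pdivrMr //.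
  have := active_remaining rw act; nra.
have w_le s : w s <= (P - cumul w t) / L'%:R.
  exact: le_trans (ramp_le rw s) C.
have C' : (P - cumul w t) / L'%:R <= P / L'%:R.
  rewrite ler_pM2r ?invr_gt0 // gerBl; apply: sumr_ge0 => i _.
  exact: (ramp_ge0 rw _).
have tN : (t < N)%N := ramp_active P0 rw act.
have v0 s : 0 <= cut P w t L' s.
  rewrite /cut; case: ifP => _; first exact: (ramp_ge0 rw _).
  by case: ifP => // _; rewrite divr_ge0 // ltW.
split.
- move=> s; rewrite v0 /= /cut; case: ifP => _.
    exact: le_trans (w_le s) C'.
  by case: ifP => // _; rewrite divr_ge0 // ltW.
- by move=> s sN; rewrite /cut !ifF //; lia.
- rewrite -[RHS](cumul_cut P w t L'0); apply: cumul_stable; last lia.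
  by move=> s sN; rewrite /cut !ifF //; lia.
move=> s u su; case: (ltnP u t) => ut.
  rewrite cumul_cut_lo // => act_u; rewrite /cut ut ifT; last lia.
  exact: mono.
(* Once the window is over all of [P] has been received, so no later round is active. *)
move=> act_u; have uL : (u < t + L')%N.
  rewrite ltnNge; apply/negP => tu; move: act_u; rewrite leNgt => /negP; apply.
  apply: lt_le_trans (threshold_lt P0) _.
  by rewrite -{1}(cumul_cut P w t L'0); apply: cumul_le => //; lia.
rewrite {2}/cut ifF ?uL; last lia.
rewrite /cut; case: ifP => // _; case: ifP => // _.
by rewrite divr_ge0 // ltW.
Qed.

(** * Bounding the allocated value of a ramp *)

(* Abel summation: the left-hand side is at most [w m.-1 * (1 - r m)]. *)
Lemma shift1_le w r B m : (forall t, 0 <= w t <= B) -> (forall t, 0 <= r t <= 1) ->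
  (forall s t, (s <= t < m)%N -> w s <= w t) ->
  \sum_(t < m) w t * r t <= \sum_(t < m) w t * r t.+1 + B.
Proof.
move=> wB r01; case: m => [|m] mono.
  by rewrite !big_ord0 add0r; have /andP[/le_trans] := wB 0%N; apply.
suff : \sum_(t < m.+1) w t * r t <= \sum_(t < m.+1) w t * r t.+1 +
    w m * (1 - r m.+1).
  move/le_trans; apply; rewrite lerD2l.
  have /andP[? ?] := wB m; have /andP[? ?] := r01 m.+1; nra.
elim: m mono => [|m IH] mono.
  by rewrite !big_ord1 /=; have /andP[? ?] := wB 0%N; have /andP[? ?] := r01 0%N; nra.
rewrite big_ord_recr [in leRHS]big_ord_recr /=.
have {}IH := IH (fun s t (st : (s <= t < m.+1)%N) =>
  mono s t (ltac:(by move: st; lia))).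
have := mono m m.+1; rewrite leqnSn ltnSn => /(_ isT).
have /andP[? ?] := r01 m.+1; have /andP[? ?] := wB m; nra.
Qed.

Lemma shift_le w r B m j : (forall t, 0 <= w t <= B) -> (forall t, 0 <= r t <= 1) ->
  (forall s t, (s <= t < m)%N -> w s <= w t) ->
  \sum_(t < m) w t * r t <= \sum_(t < m) w t * r (t + j)%N + j%:R * B.
Proof.
move=> wB r01 mono; elim: j => [|j IH].
  by rewrite mul0r addr0; under [leRHS]eq_bigr do rewrite addn0.
apply: (le_trans IH).
have := shift1_le wB (fun t => r01 (t + j)%N) mono.
under [X in _ <= X + _]eq_bigr do rewrite addSnnS.
by rewrite -natr1; lra.
Qed.

(* [U t] stands for the utility of [cut P w t L'], which gains at least the sum
   in the last hypothesis by imitating [w]. The window of [L'] rounds is replaced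
   by its starting point by shifting the nondecreasing [w], at a cost of at most
   [L'] times its largest value. *)
Lemma ramp_alloc_le P L N L' w r U T :
  0 < P -> (0 < L')%N -> (N <= T)%N -> ramp P L N w ->
  (forall t, 0 <= r t <= 1) ->
  (forall t, cumul w t.+1 <= threshold P ->
     \sum_(j < L') r (t + j)%N * ((P - cumul w t) / L'%:R - w (t + j)%N) <= U t) ->
  \sum_(t < T) r t * w t <=
    P * expR (-1) + (L'%:R *+ 2 + 1) * (P / L%:R) + \sum_(t < T) hazard P w t * U t.
Proof.
move=> P0 L'0 NT rw r01 gain.
have [m [mN mP]] := ramp_stop P0 rw.
have L'R : 0 < L'%:R :> R by rewrite ltr0n.
have w0 := ramp_ge0 rw; have wB := ramp_le rw.
have q0 := hazard_ge0 P0 rw.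
have [_ _ _ mono] := rw.
have tot := ramp_total rw NT.
have mT : (m <= T)%N by rewrite (leq_trans _ NT) // ltnW.
set B := P / L%:R in wB *.
have B0 : 0 <= B by rewrite (le_trans (w0 0%N)).
have haz : \sum_(t < T) hazard P w t * U t = \sum_(t < m) hazard P w t * U t.
  rewrite [RHS](big_ord_widen T (fun t => hazard P w t * U t)) // [RHS]big_mkcond.
  apply: eq_bigr => t _; case: ifP => //.
  by rewrite -mP /hazard => ->; rewrite mul0r.
(* The inactive rounds hold at most [P / e] of value, plus [B] because round [m] crosses the
   threshold only partway. *)
have tail : \sum_(t < T) r t * w t <=
    \sum_(t < m) w t * r t + (P * expR (-1) + B).
  have -> : \sum_(t < T) r t * w t =
      \sum_(t < m) w t * r t + \sum_(t < T | ~~ (t < m)%N) r t * w t.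
    rewrite (bigID (fun t : 'I_T => (t < m)%N)) /=; congr (_ + _).
    rewrite -(big_ord_widen T (fun t => r t * w t)) //.
    by apply: eq_bigr => t _; rewrite mulrC.
  rewrite lerD2l.
  apply: (@le_trans _ _ (\sum_(t < T | ~~ (t < m)%N) w t)).
    apply: ler_sum => t _; have /andP[_ r1] := r01 t.
    by rewrite ler_piMl // w0.
  have -> : \sum_(t < T | ~~ (t < m)%N) w t = P - cumul w m.
    rewrite -tot /cumul [X in _ = X - _](bigID (fun t : 'I_T => (t < m)%N)) /=.
    by rewrite -(big_ord_widen T w) // addrC addrK.
  have := mP m; rewrite ltnn cumulS /threshold => /negbT; rewrite -ltNge.
  by have := wB m; lra.
(* Average of [shift_le] over the shifts [j < L']. *)
have head : \sum_(t < m) w t * r t <=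
    L'%:R^-1 * \sum_(t < m) w t * \sum_(j < L') r (t + j)%N + L'%:R * B.
  have -> : \sum_(t < m) w t * \sum_(j < L') r (t + j)%N =
      \sum_(j < L') \sum_(t < m) w t * r (t + j)%N.
    by rewrite exchange_big; apply: eq_bigr => t _; rewrite mulr_sumr.
  rewrite -(ler_pM2r L'R) mulrDl [_^-1 * _]mulrC divfK ?gt_eqF //.
  have -> : (\sum_(t < m) w t * r t) * L'%:R = \sum_(j < L') \sum_(t < m) w t * r t.
    by rewrite sumr_const card_ord mulr_natr.
  have -> : L'%:R * B * L'%:R = \sum_(j < L') L'%:R * B.
    by rewrite sumr_const card_ord mulr_natr.
  rewrite -big_split /=; apply: ler_sum => j _.
  have wB' t : 0 <= w t <= B by rewrite w0 wB.
  have mono' s t : (s <= t < m)%N -> w s <= w t.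
    by case/andP=> st tm; apply: mono => //; rewrite mP.
  apply: le_trans (shift_le j wB' r01 mono') _.
  by rewrite lerD2l ler_wpM2r // ler_nat ltnW.
(* Pays for the subtracted terms [w (t + j)] in [gain]: at most [L' * B] per window, weighted by
   hazards of total mass at most 1. *)
have slack : \sum_(t < m) hazard P w t * (L'%:R * B) <= L'%:R * B.
  rewrite -mulr_suml ler_piMl ?(mulr_ge0 (ler0n _ _) B0) //.
  exact: hazard_sum_le1 P0 rw m.
(* The hazard is chosen so that [w t / L'] equals the hazard times the new rate
   [(P - cumul w t) / L']. *)
have body : L'%:R^-1 * \sum_(t < m) w t * \sum_(j < L') r (t + j)%N <=
    \sum_(t < m) hazard P w t * U t + L'%:R * B.
  apply: le_trans (lerD (lexx _) slack).
  rewrite mulr_sumr -big_split /=; apply: ler_sum => t _.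
  have act : cumul w t.+1 <= threshold P by rewrite mP.
  have D := active_remaining_gt0 P0 rw act.
  rewrite -mulrDr.
  have -> : L'%:R^-1 * (w t * \sum_(j < L') r (t + j)%N) =
     hazard P w t * ((P - cumul w t) / L'%:R * \sum_(j < L') r (t + j)%N).
    by rewrite /hazard act; field; rewrite !gt_eqF.
  rewrite ler_wpM2l //; apply: le_trans (lerD (gain t act) (lexx _)).
  have -> : L'%:R * B = \sum_(j < L') B by rewrite sumr_const card_ord mulr_natl.
  rewrite mulr_sumr -big_split /=; apply: ler_sum => j _.
  have /andP[? ?] := r01 (t + j)%N; have := wB (t + j)%N; have := w0 (t + j)%N.
  nra.
rewrite haz; move: tail head body; rewrite mulrDl mul1r mulr2n mulrDl; lra.
Qed.

(** * Averages over iterated random cuts *)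

Section Averaging.
Variables (P : R) (L : nat -> nat) (T : nat).
Implicit Types (F G : (nat -> R) -> R).

Definition step (l : nat) F w : R :=
  \sum_(t < T) hazard P w t * F (cut P w t l)
    + (1 - \sum_(t < T) hazard P w t) * F w.

Definition steady (l s : nat) : R := if (s < l)%N then P / l%:R else 0.

(** The law of the stage-[k] type, encoded as a functional on [F]: start from a constant rate, then
    modify [k] times. The latest modification is absorbed into [F]. *)
Fixpoint expect (k : nat) F : R :=
  if k is k'.+1 then expect k' (step (L k) F) else F (steady (L 0%N)).

Definition span (k : nat) : nat := \sum_(j < k.+1) L j.

Lemma expectD k F G : expect k (fun w => F w + G w) = expect k F + expect k G.
Proof.
elim: k F G => [//|k IH] F G; rewrite /= -IH; congr expect; apply/funext => w.
rewrite /step mulrDr addrACA -big_split /=; congr (_ + _).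
by apply: eq_bigr => t _; rewrite mulrDr.
Qed.

Lemma expectZ k a F : expect k (fun w => a * F w) = a * expect k F.
Proof.
elim: k F => [//|k IH] F; rewrite /= -IH; congr expect; apply/funext => w.
rewrite /step mulrDr mulr_sumr [a * ((1 - _) * _)]mulrCA; congr (_ + _).
by apply: eq_bigr => t _; rewrite mulrCA.
Qed.

Lemma expect_cst k a : expect k (fun=> a) = a.
Proof.
elim: k => [//|k IH] /=; rewrite -[RHS]IH; congr expect; apply/funext => w.
by rewrite /step -mulr_suml -mulrDl addrC subrK mul1r.
Qed.

Lemma expect_sum k n (F : 'I_n -> (nat -> R) -> R) :
  expect k (fun w => \sum_(i < n) F i w) = \sum_(i < n) expect k (F i).
Proof.
elim: n F => [|n IH] F.
  rewrite big_ord0 -[RHS](expect_cst k 0); congr expect; apply/funext => w.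
  by rewrite big_ord0.
rewrite big_ord_recl -IH -expectD; congr expect; apply/funext => w.
by rewrite big_ord_recl.
Qed.

(** A finite Fubini exchange, needed because the two bidders are modified independently. *)
Lemma expect_step k l (F : (nat -> R) -> (nat -> R) -> R) w :
  step l (fun w1 => expect k (F w1)) w = expect k (fun w2 => step l (F^~ w2) w).
Proof.
rewrite /step expectD expect_sum expectZ; congr (_ + _).
by apply: eq_bigr => t _; rewrite expectZ.
Qed.

Lemma ramp_steady l : 0 < P -> (0 < l)%N -> ramp P l l (steady l).
Proof.
move=> P0 l0; have lR : 0 < l%:R :> R by rewrite ltr0n.
have tot : cumul (steady l) l = P.
  rewrite /cumul (eq_bigr (fun=> P / l%:R)); last first.
    by move=> t _; rewrite /steady ltn_ord.
  by rewrite sumr_const card_ord -(mulr_natr (_ / _)) divfK ?gt_eqF.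
have c0 : 0 <= P / l%:R by rewrite divr_ge0 // ltW.
have s0 t : 0 <= steady l t by rewrite /steady; case: ifP.
split=> //.
- by move=> t; rewrite s0 /= /steady; case: ifP.
- by move=> t lt; rewrite /steady ltnNge lt.
move=> s t st act; have tl : (t < l)%N.
  rewrite ltnNge; apply/negP => lt; move: act; rewrite leNgt => /negP; apply.
  apply: lt_le_trans (threshold_lt P0) _.
  by rewrite -{1}tot; apply: cumul_le => //; rewrite ltnW.
by rewrite /steady tl; case: ifP.
Qed.

Hypothesis P_gt0 : 0 < P.

Section Decay.
Variable n : nat.
Hypothesis L_gt0 : forall k, (k <= n)%N -> (0 < L k)%N.
Hypothesis L_decay :
  forall k, (k < n)%N -> (L k.+1)%:R <= (L k)%:R * expR (-1) :> R.

(** All weights are nonnegative, as the hazards sum to at most 1, and every type of positive weight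
    at stage [k] is a ramp with parameters [L k] and [span k]. *)
Lemma expect_le k F G : (k <= n)%N ->
  (forall w, ramp P (L k) (span k) w -> F w <= G w) -> expect k F <= expect k G.
Proof.
elim: k F G => [|k IH] F G kn FG /=.
  by apply: FG; rewrite /span big_ord1; apply: ramp_steady => //; exact: L_gt0.
have L'0 := L_gt0 kn; have LL := L_decay kn.
apply: IH => [|w rw]; first exact: ltnW.
have spanS : span k.+1 = (span k + L k.+1)%N by rewrite /span big_ord_recr.
apply: lerD.
  apply: ler_sum => t _; rewrite /hazard; case: ifP => [act|]; last by rewrite !mul0r.
  rewrite ler_wpM2l //.
    by have := hazard_ge0 P_gt0 rw t; rewrite /hazard act.
  by apply: FG; rewrite spanS; apply: ramp_cut rw act.
rewrite ler_wpM2l ?subr_ge0 ?(hazard_sum_le1 P_gt0 rw) //; apply: FG.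
apply: ramp_weaken rw; first exact: ltW.
  rewrite L'0 -(ler_nat R) (le_trans LL) // ler_piMr ?ler0n //.
by rewrite spanS leq_addr.
Qed.

End Decay.
End Averaging.

(** * Incentives of a single bidder *)

Section Bidder.
Variables (T : nat) (M : mechanism R T).
Hypothesis M_truthful : truthful M.
Implicit Types (p : profile R T) (i : 'I_2).

Definition restrict w : btype R T := fun t => w t.

Definition utility p i : R :=
  \sum_(t < T) (alloc M p i t * p i t - price M p i t) + reimb M p i.

Definition payment p i : R := \sum_(t < T) price M p i t - reimb M p i.

Lemma revenueE p : revenue M p = \sum_(i < 2) payment p i.
Proof. by rewrite /revenue -sumrB. Qed.

Lemma payment_utility p i :
  payment p i + utility p i = \sum_(t < T) alloc M p i t * p i t.
Proof. by rewrite /payment /utility sumrB; ring. Qed.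

Lemma replace_typeK p i u u' :
  replace_type (replace_type p i u) i u' = replace_type p i u'.
Proof. by apply/funext => j; rewrite /replace_type; case: eqP. Qed.

Lemma replace_type_at p i u : replace_type p i u i = u.
Proof. by rewrite /replace_type eqxx. Qed.

Lemma valid_replace p i u :
  valid_profile p -> valid_type u -> valid_profile (replace_type p i u).
Proof. by move=> vp vu j; rewrite /replace_type; case: eqP. Qed.

(** Bidder [i] reports [u] and defaults at [tau]. Limited liability caps each price by the value [u]
    assigns to the allocation, so the surplus is at least the allocation times [p i t - u t]. *)
Lemma mimic_le p i u (tau : 'I_T) : valid_profile p -> valid_type u ->
  (forall t : 'I_T, (t <= tau)%N -> u t <= p i t) ->
  \sum_(t < T | (t <= tau)%N) alloc M (replace_type p i u) i t * (p i t - u t)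
    <= utility p i.
Proof.
move=> vp vu up; set q := replace_type p i u.
have vq : valid_profile q by exact: valid_replace.
have [feas ll ic] := M_truthful.
have a0 t : 0 <= alloc M q i t by have [/(_ i t)/andP[]] := feas q vq.
have x_le t : price M q i t <= alloc M q i t * u t.
  by have := ll q vq i t; rewrite /q replace_type_at.
have xp (t : 'I_T) : (t <= tau)%N -> price M q i t <= alloc M q i t * p i t.
  by move=> tt; rewrite (le_trans (x_le t)) // ler_wpM2l // up.
apply: le_trans (ic p vp i u vu tau xp).
(* At [tau] the default cancels the price, and [0 <= u tau] suffices there. *)
rewrite (bigD1 tau) //= [X in _ <= X + _](bigD1 tau) //= -/q.
rewrite addrAC subrK; apply: lerD.
  by rewrite ler_wpM2l // gerBl; have /andP[] := vu tau.
by apply: ler_sum => t _; have := x_le t; lra.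
Qed.

(** Imitating one's own type and defaulting in the first round has lower bound 0 in [mimic_le]. *)
Lemma utility_ge0 p i : (0 < T)%N -> valid_profile p -> 0 <= utility p i.
Proof.
move=> T0 vp; apply: le_trans (@mimic_le p i (p i) (Ordinal T0) vp (vp i) _).
  by rewrite big1 // => t _; rewrite subrr mulr0.
by [].
Qed.

Lemma valid_ramp P L N w : (0 < L)%N -> P <= L%:R -> ramp P L N w ->
  valid_type (restrict w).
Proof.
move=> L0 PL rw t; rewrite /restrict; have [/(_ t)/andP[-> wB] _ _ _] := rw.
by rewrite (le_trans wB) // ler_pdivrMr ?ltr0n // mul1r.
Qed.

Lemma total_ramp P L N w : (N <= T)%N -> ramp P L N w ->
  \sum_(t < T) restrict w t = P.
Proof. by move=> NT rw; rewrite -(ramp_total rw NT). Qed.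

(** Each type [cut P w t L'] can imitate [w] until its window ends. The resulting utility bounds
    feed [ramp_alloc_le], whose left side is payment plus utility of [w]. *)
Lemma payment_step P L N L' p i w : 0 < P -> (0 < L')%N -> P <= L'%:R ->
  L'%:R <= L%:R * expR (-1) :> R -> (N + L' <= T)%N ->
  valid_profile p -> ramp P L N w ->
  payment (replace_type p i (restrict w)) i +
      utility (replace_type p i (restrict w)) i <=
    P * expR (-1) + (L'%:R *+ 2 + 1) * (P / L%:R) +
    step P T L' (fun v => utility (replace_type p i (restrict v)) i) w.
Proof.
move=> P0 L'0 PL' LL NT vp rw; rewrite payment_utility replace_type_at.
have L'L : (L' <= L)%N.
  by rewrite -(ler_nat R) (le_trans LL) // ler_piMr ?expR_le1 ?lerN10.
have vw : valid_type (restrict w).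
  apply: valid_ramp rw; first exact: leq_trans L'L.
  by rewrite (le_trans PL') // ler_nat.
set q := replace_type p i (restrict w).
have vq : valid_profile q by exact: valid_replace.
have [feas _ _] := M_truthful.
(* The allocation is extended by 0 beyond the game. *)
pose r s := if insub s is Some t then alloc M q i t else 0.
have rE (t : 'I_T) : r t = alloc M q i t by rewrite /r valK.
have r01 s : 0 <= r s <= 1.
  rewrite /r; case: insubP => [t _ _|_]; last by rewrite lexx ler01.
  by have [/(_ i t)] := feas q vq.
pose U t := utility (replace_type p i (restrict (cut P w t L'))) i.
have T0 : (0 < T)%N by apply: leq_trans NT; rewrite addn_gt0 L'0 orbT.
have Uw : 0 <= utility q i by exact: utility_ge0.
have gain t : cumul w t.+1 <= threshold P ->
    \sum_(j < L') r (t + j)%N * ((P - cumul w t) / L'%:R - w (t + j)%N) <= U t.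
  move=> act; have rc := ramp_cut P0 L'0 LL rw act.
  set v := cut P w t L' in rc.
  have vv : valid_type (restrict v) by apply: valid_ramp rc.
  have tN : (t < N)%N := ramp_active P0 rw act.
  (* The zero-based last round of the window, where the imitation defaults. *)
  have tauT : ((t + L').-1 < T)%N by lia.
  have wv s : (s < t + L')%N -> w s <= v s.
    rewrite /v /cut => ->; case: ifP => // _.
    have LR : 0 < L%:R :> R by rewrite ltr0n (leq_trans L'0).
    apply: le_trans (ramp_le rw s) _.
    rewrite ler_pdivlMr ?ltr0n // mulrAC ler_pdivrMr //.
    have := active_remaining rw act; nra.
  have wv' (s : 'I_T) : (s <= Ordinal tauT)%N ->
      restrict w s <= replace_type p i (restrict v) i s.
    by rewrite replace_type_at /= => ss; apply: wv; lia.
  apply: le_trans (mimic_le (valid_replace i vp vv) vw wv').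
  rewrite replace_typeK -/q replace_type_at /=.
  have -> : \sum_(s < T | (s <= (t + L').-1)%N)
      alloc M q i s * (restrict v s - restrict w s) =
      \sum_(s < t + L') r s * (v s - w s).
    rewrite [RHS](big_ord_widen T (fun s => r s * (v s - w s))); last lia.
    by apply: eq_big => s; [lia | rewrite rE].
  rewrite big_split_ord /= [X in _ <= X + _]big1 ?add0r => [|s _]; last first.
    by rewrite /v /cut ltn_ord subrr mulr0.
  apply: ler_sum => j _; rewrite /v /cut ifF ?ifT ?lexx //; last lia.
  by rewrite ltn_add2l.
have NT' : (N <= T)%N by apply: leq_trans NT; exact: leq_addr.
have := ramp_alloc_le P0 L'0 NT' rw r01 gain.
under eq_bigr do rewrite rE.
(* The mass that [step] leaves on [w] contributes a nonnegative utility. *)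
move/le_trans; apply; rewrite lerD2l /step lerDl mulr_ge0 // subr_ge0.
exact: hazard_sum_le1 P0 rw T.
Qed.

End Bidder.

(** * Two bidders on a grid of stages *)

(** Summed over the grid, [A] telescopes along [k] and [B] along [l]: [2 * n] boundary differences
    of size at most [D] dominate [n ^ 2 * c]. *)
Lemma grid_telescope (A B : nat -> nat -> R) n c D : (0 < n)%N ->
  (forall k l, (k < n)%N -> (l < n)%N ->
     c <= (A k.+1 l - A k l) + (B k l.+1 - B k l)) ->
  (forall k l, (k <= n)%N -> (l <= n)%N -> 0 <= A k l <= D /\ 0 <= B k l <= D) ->
  n%:R * c <= D *+ 2.
Proof.
move=> n0 cAB bnd; have nR : 0 < n%:R :> R by rewrite ltr0n.
have tele (u : nat -> R) : \sum_(k < n) (u k.+1 - u k) = u n - u 0%N.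
  by rewrite -(big_mkord xpredT (fun k => u k.+1 - u k)) telescope_sumr.
have : \sum_(k < n) \sum_(l < n) c <= n%:R * (D *+ 2).
  apply: (@le_trans _ _ (\sum_(k < n) \sum_(l < n)
      ((A k.+1 l - A k l) + (B k l.+1 - B k l)))).
    by apply: ler_sum => k _; apply: ler_sum => l _; apply: cAB.
  under eq_bigr do rewrite big_split /=.
  rewrite big_split /= exchange_big /=.
  under eq_bigr => l _ do rewrite (tele (A^~ l)).
  under [X in _ + X <= _]eq_bigr => k _ do rewrite (tele (B k)).
  rewrite -big_split /= mulr_natl -[n in leRHS]card_ord -sumr_const.
  apply: ler_sum => k _; have kn := ltnW (ltn_ord k).
  have [/andP[_ ?] _] := bnd n k (leqnn n) kn.
  have [/andP[? _] _] := bnd 0%N k (leq0n n) kn.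
  have [_ /andP[_ ?]] := bnd k n kn (leqnn n).
  have [_ /andP[? _]] := bnd k 0%N kn (leq0n n).
  by rewrite mulr2n; lra.
under eq_bigr do rewrite sumr_const card_ord.
by rewrite sumr_const card_ord -(mulr_natl (c *+ n)) -(mulr_natl c) ler_pM2l.
Qed.

Section TwoBidders.
Variables (T : nat) (M : mechanism R T) (P alpha C : R) (L : nat -> nat) (n : nat).
Hypotheses (M_truthful : truthful M) (P_gt0 : 0 < P).
Hypothesis L_gt0 : forall k, (k <= n)%N -> (0 < L k)%N.
Hypothesis L_decay :
  forall k, (k < n)%N -> (L k.+1)%:R <= (L k)%:R * expR (-1) :> R.
Hypothesis P_le : forall k, (k <= n)%N -> P <= (L k)%:R.
Hypothesis span_le : (span L n <= T)%N.
Hypothesis alpha_ge0 : 0 <= alpha.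
Hypothesis M_competitive :
  forall v : profile R T, valid_profile v -> alpha * rev_STB v - C <= revenue M v.

Let bidder1 : 'I_2 := ord0.
Let bidder2 : 'I_2 := lift ord0 ord0.

Definition duo (w1 w2 : nat -> R) : profile R T :=
  fun i => restrict (if i == ord0 then w1 else w2).

Lemma duo_replace1 w1 w2 w :
  replace_type (duo w1 w2) bidder1 (restrict w) = duo w w2.
Proof. by apply/funext => j; rewrite /replace_type /duo; case: eqP. Qed.

Lemma duo_replace2 w1 w2 w :
  replace_type (duo w1 w2) bidder2 (restrict w) = duo w1 w.
Proof.
by apply/funext => j; rewrite /replace_type /duo; case: j => [[|[|]]].
Qed.

Definition expect2 k l (F : (nat -> R) -> (nat -> R) -> R) : R :=
  expect P L T k (fun w1 => expect P L T l (F w1)).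

Let good k w := ramp P (L k) (span L k) w.

Lemma span_le_T k : (k <= n)%N -> (span L k <= T)%N.
Proof.
move=> kn; apply: leq_trans span_le.
by rewrite /span [leqRHS](bigID (fun j : 'I_n.+1 => (j < k.+1)%N)) /=
  -(big_ord_widen n.+1 L) // leq_addr.
Qed.

Lemma T_gt0 : (0 < T)%N.
Proof.
apply: leq_trans (span_le_T (leq0n n)); rewrite /span big_ord1; exact: L_gt0.
Qed.

Lemma valid_duo k l w1 w2 : (k <= n)%N -> (l <= n)%N -> good k w1 -> good l w2 ->
  valid_profile (duo w1 w2).
Proof.
move=> kn ln g1 g2 i; rewrite /duo; case: ifP => _.
  by apply: valid_ramp g1; [exact: L_gt0 | exact: P_le].
by apply: valid_ramp g2; [exact: L_gt0 | exact: P_le].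
Qed.

Lemma total_duo k l w1 w2 i : (k <= n)%N -> (l <= n)%N -> good k w1 -> good l w2 ->
  total_value (duo w1 w2) i = P.
Proof.
move=> kn ln g1 g2; rewrite /total_value /duo; case: ifP => _.
  exact: total_ramp (span_le_T kn) g1.
exact: total_ramp (span_le_T ln) g2.
Qed.

Lemma expect2_le k l F G : (k <= n)%N -> (l <= n)%N ->
  (forall w1 w2, good k w1 -> good l w2 -> F w1 w2 <= G w1 w2) ->
  expect2 k l F <= expect2 k l G.
Proof.
move=> kn ln FG; apply: (expect_le T P_gt0 L_gt0 L_decay) => // w1 g1.
by apply: (expect_le T P_gt0 L_gt0 L_decay) => // w2 g2; exact: FG.
Qed.

Lemma expect2D k l F G :
  expect2 k l (fun w1 w2 => F w1 w2 + G w1 w2) = expect2 k l F + expect2 k l G.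
Proof.
rewrite /expect2 -expectD; congr expect; apply/funext => w1.
by rewrite expectD.
Qed.

Lemma expect2_cst k l a : expect2 k l (fun _ _ => a) = a.
Proof.
rewrite -[RHS](expect_cst P L T k); congr expect; apply/funext => w1.
exact: expect_cst.
Qed.

Let err k : R := P * expR (-1) + ((L k.+1)%:R *+ 2 + 1) * (P / (L k)%:R).

Lemma payment1_le k l : (k < n)%N -> (l <= n)%N ->
  expect2 k l (fun w1 w2 => payment M (duo w1 w2) bidder1) +
  expect2 k l (fun w1 w2 => utility M (duo w1 w2) bidder1) <=
  err k + expect2 k.+1 l (fun w1 w2 => utility M (duo w1 w2) bidder1).
Proof.
move=> kn ln; have kn' := ltnW kn.
rewrite -expect2D -(expect2_cst k l (err k)).
(* Bidder 1 is averaged outermost, so its extra step must be moved inside the average over bidder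
   2. *)
have -> : expect2 k.+1 l (fun w1 w2 => utility M (duo w1 w2) bidder1) =
    expect2 k l (fun w1 w2 =>
      step P T (L k.+1) (fun w => utility M (duo w w2) bidder1) w1).
  by rewrite /expect2 /=; congr expect; apply/funext => w1; rewrite expect_step.
rewrite -expect2D; apply: expect2_le => // w1 w2 g1 g2.
have vd := valid_duo kn' ln g1 g2.
have NT : (span L k + L k.+1 <= T)%N.
  by have := span_le_T kn; rewrite /span big_ord_recr.
have := payment_step M_truthful bidder1 P_gt0 (L_gt0 kn) (P_le kn)
  (L_decay kn) NT vd g1.
rewrite duo_replace1; congr (_ <= _ + _); congr (step _ _ _ _ _).
by apply/funext => w; rewrite duo_replace1.
Qed.

Lemma payment2_le k l : (k <= n)%N -> (l < n)%N ->
  expect2 k l (fun w1 w2 => payment M (duo w1 w2) bidder2) +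
  expect2 k l (fun w1 w2 => utility M (duo w1 w2) bidder2) <=
  err l + expect2 k l.+1 (fun w1 w2 => utility M (duo w1 w2) bidder2).
Proof.
move=> kn ln; have ln' := ltnW ln.
rewrite -expect2D -(expect2_cst k l (err l)).
have -> : expect2 k l.+1 (fun w1 w2 => utility M (duo w1 w2) bidder2) =
    expect2 k l (fun w1 w2 =>
      step P T (L l.+1) (fun w => utility M (duo w1 w) bidder2) w2).
  by [].
rewrite -expect2D; apply: expect2_le => // w1 w2 g1 g2.
have vd := valid_duo kn ln' g1 g2.
have NT : (span L l + L l.+1 <= T)%N.
  by have := span_le_T ln; rewrite /span big_ord_recr.
have := payment_step M_truthful bidder2 P_gt0 (L_gt0 ln) (P_le ln)
  (L_decay ln) NT vd g2.
rewrite duo_replace2; congr (_ <= _ + _); congr (step _ _ _ _ _).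
by apply/funext => w; rewrite duo_replace2.
Qed.

Lemma revenue_duo_ge k l w1 w2 : (k <= n)%N -> (l <= n)%N ->
  good k w1 -> good l w2 ->
  alpha * P - C <= payment M (duo w1 w2) bidder1 + payment M (duo w1 w2) bidder2.
Proof.
move=> kn ln g1 g2; have := M_competitive (valid_duo kn ln g1 g2).
by rewrite /rev_STB !(total_duo _ kn ln g1 g2) minxx revenueE
  !big_ord_recl big_ord0 addr0.
Qed.

(** Competitiveness keeps total payments at or above [- C], while payment plus utility is at most
    [P] per bidder. So the utilities sum to at most [2 * P + C], and both are nonnegative. *)
Lemma utility_duo_bounds k l w1 w2 : (k <= n)%N -> (l <= n)%N ->
  good k w1 -> good l w2 -> forall i,
  0 <= utility M (duo w1 w2) i <= P *+ 2 + C.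
Proof.
move=> kn ln g1 g2; have vd := valid_duo kn ln g1 g2.
have u0 i := utility_ge0 M_truthful i T_gt0 vd.
have welfare i : payment M (duo w1 w2) i + utility M (duo w1 w2) i <= P.
  rewrite payment_utility -(total_duo i kn ln g1 g2); apply: ler_sum => t _.
  have [/(_ _ vd)[/(_ i t)/andP[_ a1] _] _ _] := M_truthful.
  by rewrite ler_piMl //; have /andP[] := vd i t.
have rev := revenue_duo_ge kn ln g1 g2.
have aP : 0 <= alpha * P by rewrite mulr_ge0 // ltW.
move=> i; rewrite u0 /=.
have := welfare bidder1; have := welfare bidder2.
have := u0 bidder1; have := u0 bidder2; rewrite mulr2n.
have [->|->] : i = bidder1 \/ i = bidder2; last by lra.
  by case: i => [[|[|]]] //= ?; [left | right]; apply: val_inj.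
by lra.
Qed.

(** At each grid point the two mean utility increments together are at least the mean revenue minus
    both stage bounds; [grid_telescope] applies. *)
Lemma competitive_bound e : (0 < n)%N ->
  (forall k, (k < n)%N -> ((L k.+1)%:R *+ 2 + 1) * (P / (L k)%:R) <= e) ->
  n%:R * (alpha * P - C - (P * expR (-1) + e) *+ 2) <= (P *+ 2 + C) *+ 2.
Proof.
move=> n0 eP.
pose U i k l := expect2 k l (fun w1 w2 => utility M (duo w1 w2) i).
apply: (@grid_telescope (U bidder1) (U bidder2)) => // k l kn ln; last first.
  have bnd i : 0 <= U i k l <= P *+ 2 + C.
    apply/andP; split.
      rewrite -(expect2_cst k l 0); apply: expect2_le => // w1 w2 g1 g2.
      by have /andP[] := utility_duo_bounds kn ln g1 g2 i.
    rewrite -(expect2_cst k l (P *+ 2 + C)); apply: expect2_le => // w1 w2 g1 g2.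
    by have /andP[] := utility_duo_bounds kn ln g1 g2 i.
  by split; exact: bnd.
have rev : alpha * P - C <=
    expect2 k l (fun w1 w2 => payment M (duo w1 w2) bidder1) +
    expect2 k l (fun w1 w2 => payment M (duo w1 w2) bidder2).
  rewrite -expect2D -(expect2_cst k l (alpha * P - C)).
  apply: expect2_le => [||w1 w2 g1 g2]; [exact: ltnW | exact: ltnW |].
  exact: revenue_duo_ge (ltnW kn) (ltnW ln) g1 g2.
have := payment1_le kn (ltnW ln); have := payment2_le (ltnW kn) ln.
have := eP k kn; have := eP l ln.
rewrite /err -!/(U _ _ _) !mulr2n; lra.
Qed.

End TwoBidders.

End Stopping.

(** * Choice of parameters and contradiction *)

Unset Implicit Arguments.

Theorem theorem10 (R : realType) (alpha : R) :
  2 / expR 1 < alpha ->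
  ~ (exists M : forall T : nat, mechanism R T,
        (forall T, truthful (M T)) /\ competitive alpha M).
Proof.
move=> alpha_gt [M [M_truthful [C0 M_comp]]].
pose C := `|C0|; have C_ge0 : 0 <= C by exact: normr_ge0.
pose rho : R := expR (-1).
have rho0 : 0 < rho by exact: expR_gt0.
pose eta := alpha - 2 * rho.
have eta0 : 0 < eta by rewrite /eta subr_gt0 /rho expRN.
have alpha0 : 0 <= alpha by rewrite /eta in eta0; nra.
(* The term [expR 1] lets windows shrink by the factor [n]; [16 / eta] absorbs the terms linear in
   [P]. *)
pose n := (Num.bound (expR 1 + 16 / eta : R)).+1.
have n_gt : expR 1 + 16 / eta < n%:R.
  apply: lt_trans (_ : _ < (Num.bound (expR 1 + 16 / eta : R))%:R) _.
    by apply: archi_boundP; rewrite addr_ge0 ?expR_ge0 // divr_ge0 // ltW.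
  by rewrite ltr_nat.
have nR : 0 < n%:R :> R by rewrite ltr0n.
have n_eta : 16 <= n%:R * eta.
  rewrite -ler_pdivrMr //; apply: le_trans (ltW n_gt).
  by rewrite lerDr expR_ge0.
have n_rho : 1 <= n%:R * rho.
  rewrite /rho expRN -ler_pdivrMr ?invr_gt0 ?expR_gt0 // invrK mul1r.
  by apply: le_trans (ltW n_gt); rewrite lerDl divr_ge0 // ltW.
(* The total value [P], large enough to absorb the additive constants. *)
pose p := (Num.bound (2 * (3 * C + 2) / eta)).+1.
have p_gt : 2 * (3 * C + 2) / eta < p%:R.
  apply: lt_trans (_ : _ < (Num.bound (2 * (3 * C + 2) / eta))%:R) _.
    by apply: archi_boundP; rewrite divr_ge0 ?ltW //; lra.
  by rewrite ltr_nat.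
have pR : 0 < p%:R :> R by rewrite ltr0n.
(* Windows shrink by the factor [n] per stage down to [L n = p], which keeps every value at most
   1. *)
pose L k := (p * n ^ (n - k))%N.
have L_gt0 k : (k <= n)%N -> (0 < L k)%N by rewrite muln_gt0 expn_gt0.
have LS k : (k < n)%N -> (L k)%:R = (L k.+1)%:R * n%:R :> R.
  by move=> kn; rewrite -natrM /L -mulnA -expnSr subnSK.
have L_decay k : (k < n)%N -> (L k.+1)%:R <= (L k)%:R * expR (-1) :> R.
  by move=> kn; rewrite (LS k kn) -mulrA ler_peMr.
have P_le k : (k <= n)%N -> p%:R <= (L k)%:R :> R.
  by rewrite ler_nat leq_pmulr // expn_gt0.
have comp (v : profile R (span L n)) : valid_profile v ->
    alpha * rev_STB v - C <= revenue (M (span L n)) v.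
  move=> /M_comp; apply: le_trans; rewrite lerD2l lerN2; exact: ler_norm.
have err k : (k < n)%N ->
    ((L k.+1)%:R *+ 2 + 1) * (p%:R / (L k)%:R) <= 2 * p%:R / n%:R + 1 :> R.
  move=> kn; have Lk1 : 0 < (L k.+1)%:R :> R by rewrite ltr0n L_gt0.
  have Lk : 0 < (L k)%:R :> R by rewrite ltr0n L_gt0 // ltnW.
  rewrite mulrDl mul1r lerD //; last by rewrite ler_pdivrMr // mul1r P_le // ltnW.
  rewrite le_eqVlt; apply/orP; left; apply/eqP; rewrite (LS k kn) mulr2n.
  by field; rewrite !gt_eqF.
have := competitive_bound (M_truthful _) pR L_gt0 L_decay P_le (leqnn _) alpha0
  comp (ltn0Sn _) err.
rewrite -/rho !mulr2n.
set P := p%:R in pR p_gt *; set N := n%:R in nR n_eta *.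
have -> : N * (alpha * P - C - (P * rho + (2 * P / N + 1) + (P * rho + (2 * P / N + 1))))
   = N * eta * P - N * (C + 2) - 4 * P.
  by rewrite /eta; field; rewrite gt_eqF.
have {}p_gt : 2 * (3 * C + 2) < P * eta by rewrite -ltr_pdivrMr.
have N1 : 1 <= N by rewrite ler1n.
have : N * (2 * (3 * C + 2)) < N * (P * eta) by rewrite ltr_pM2l.
have : 16 * P <= N * eta * P by rewrite ler_pM2r.
(* Half of [N * eta * P] is at least [8 * P]; the other half exceeds [N * (3 * C + 2)], hence
   [N * (C + 2) + 2 * C]. *)
nra.
Qed.
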